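(* Let $(X,D)$ be a metric space, $P=V\subseteq X$ a finite point set with $|V|\ge 2$ and aspect ratio $\Delta$, and $\alpha>1$. Let $G=(V,E)$ be the graph built by the slow preprocessing procedure (each $p\in V$ gets out-neighbour set $\mathrm{RobustPruning}(p,V,\alpha)$); in particular $G$ is $\alpha$-shortcut reachable. Let $s\in V$ be any start vertex, $q\in X$ any query point, and $\epsilon>0$. Then $\mathrm{GreedySearch}(s,q,1)$ (queue length $L=1$, i.e. no back-tracking) finds a $\left(\frac{\alpha+1}{\alpha-1}+\epsilon\right)$-approximate nearest neighbor of $q$ in $O\!\left(\log_\alpha\frac{\Delta}{(\alpha-1)\epsilon}\right)$ steps; that is, among the vertices scanned in the first $O\!\left(\log_\alpha\frac{\Delta}{(\alpha-1)\epsilon}\right)$ steps (or all scanned vertices, if the search terminates earlier) there is a vertex $v$ with $D(v,q)\le\left(\frac{\alpha+1}{\alpha-1}+\epsilon\right)\min_{x\in V}D(x,q)$.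
   Context: $\mathrm{RobustPruning}(p,V,\alpha)$ (no-degree-limit version): initialize $U=V\setminus\{p\}$, $N_{out}(p)=\emptyset$. While $U\neq\emptyset$: let $v=\arg\min_{u\in U}D(u,p)$; add $v$ to $N_{out}(p)$; remove $v$ from $U$; remove from $U$ every $w$ with $\alpha D(v,w)\le D(p,w)$. Output $N_{out}(p)$. The graph has edges $(p,u)$ for $u\in N_{out}(p)$. $G$ is $\alpha$-shortcut reachable if for every vertex $p$ and every vertex $q\ne p$, either $(p,q)\in E$ or there is $p'$ with $(p,p')\in E$ and $\alpha D(p',q)\le D(p,q)$. $\mathrm{GreedySearch}(s,q,L)$: set $A=\{s\}$, $U=\emptyset$. While $A\setminus U\neq\emptyset$: let $v=\arg\min_{v\in A\setminus U}D(v,q)$; set $A\leftarrow A\cup N_{out}(v)$ and $U\leftarrow U\cup\{v\}$ (we say $v$ is scanned; each iteration is one step); if $|A|>L$, replace $A$ by its $L$ points closest to $q$. Finally return $U$ sorted by increasing distance to $q$. A point $v\in V$ is a $c$-approximate nearest neighbor of $q$ if $D(v,q)\le c\cdot\min_{x\in V}D(x,q)$. The aspect ratio is $\Delta=D_{max}/D_{min}$, the ratio of the maximum to the minimum distance between distinct points of $V$.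
   Formalization: The O-bound is read as C·max(1, log_α(Δ/((α−1)ε))) with C uniform over all ε up to any prescribed bound (C depends only on that bound); a constant uniform over all ε>0 is impossible, e.g. α=2, V={0,1,2,4,…,2^k}, q=0, s=2^k, ε=2^k/2. *)

(* Defs.v *)
(* MathComp / MathComp-Analysis *)
From HB Require Import structures.
From mathcomp Require Export all_boot all_order all_algebra finmap.
From mathcomp Require Export classical_sets reals topology exp.

Set Implicit Arguments.
Unset Strict Implicit.
Unset Printing Implicit Defensive.

Import Order.TTheory GRing.Theory Num.Theory.
Local Open Scope fset_scope.
Local Open Scope ring_scope.

Definition logb (R : realType) (b x : R) : R := ln x / ln b.

Section Graph.
Context {R : realType} {X : metricType R}.
Implicit Types (V U A : {fset X}) (p q s u v w : X) (alpha c : R).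
Implicit Types (N : X -> {fset X}).

(* For a nonempty finite V, inf and sup below are a minimum and a maximum. *)
Definition nn_dist V q : R :=
  inf [set r : R | exists2 x, x \in V & r = mdist x q]%classic.

Definition pairwise_dists V : set R :=
  [set r : R | exists x y, [/\ x \in V, y \in V, x != y & r = mdist x y]]%classic.

Definition aspect_ratio V : R :=
  sup (pairwise_dists V) / inf (pairwise_dists V).

Definition approx_nn V c q v : Prop :=
  v \in V /\ mdist v q <= c * nn_dist V q.

Definition is_closest A q v : Prop :=
  v \in A /\ forall u, u \in A -> mdist v q <= mdist u q.

(* Both procedures are relations rather than functions: ties in the choice of a
   closest point, or of the L closest points, may be broken arbitrarily.  The
   existence of runs is proved at the end of the file.  [pruning_run alpha p U O O'] : the loop started in the state
   (U, N_out(p) = O) can end with N_out(p) = O'. *)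
Inductive pruning_run alpha p : {fset X} -> {fset X} -> {fset X} -> Prop :=
| pruning_done O : pruning_run alpha p fset0 O O
| pruning_step U O O' v :
    is_closest U p v ->
    pruning_run alpha p
      [fset w in U `\ v | ~~ (alpha * mdist v w <= mdist p w)] (v |` O) O' ->
    pruning_run alpha p U O O'.

Definition robust_pruning p V alpha (O : {fset X}) : Prop :=
  pruning_run alpha p (V `\ p) fset0 O.

(* A directed graph on V is given by its out-neighbourhoods N; the values of N
   outside V are irrelevant. *)
Definition slow_preprocessing V alpha N : Prop :=
  forall p, p \in V -> robust_pruning p V alpha (N p).

Definition shortcut_reachable V alpha N : Prop :=
  forall p q, p \in V -> q \in V -> q != p ->
    q \in N p \/ exists2 p', p' \in N p & alpha * mdist p' q <= mdist p q.

Definition truncation (L : nat) q A A' : Prop :=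
  if (L < #|` A|)%N then
    [/\ A' `<=` A, #|` A'| = L &
        forall x y, x \in A' -> y \in A `\` A' -> mdist x q <= mdist y q]
  else A' = A.

(* [greedy_run N q L A U tr out] : from the state (A, U) the loop can run to
   termination, scanning successively the vertices of tr and returning out. *)
Inductive greedy_run N q (L : nat) :
    {fset X} -> {fset X} -> seq X -> seq X -> Prop :=
| greedy_done A U out :
    A `\` U = fset0 ->
    perm_eq out U -> sorted (fun x y => mdist x q <= mdist y q) out ->
    greedy_run N q L A U [::] out
| greedy_step A U A' v tr out :
    is_closest (A `\` U) q v ->
    truncation L q (A `|` N v) A' ->
    greedy_run N q L A' (v |` U) tr out ->
    greedy_run N q L A U (v :: tr) out.

Definition greedy_search N s q L (tr out : seq X) : Prop :=
  greedy_run N q L [fset s] fset0 tr out.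

Lemma is_closest_exists A q : A != fset0 -> exists v, is_closest A q v.
Proof.
case/fset0Pn => x xA.
case: (@arg_minP _ _ A (FSetSub xA) xpredT (fun u : A => mdist (val u) q) isT) => v _ vmin.
exists (val v); split; first exact: valP.
by move=> u uA; exact: (vmin (FSetSub uA)).
Qed.

Lemma truncation_exists L A q : exists A', truncation L q A A' /\ A' `<=` A.
Proof.
rewrite /truncation; case: ltnP => [LA|_]; last by exists A.
pose r (x y : X) := mdist x q <= mdist y q.
have rtot : total r by move=> x y; exact: le_total.
have rtr : transitive r by move=> y x z; exact: le_trans.
pose s := sort r A.
have sP : sorted r s by exact: sort_sorted.
have us : uniq s by rewrite sort_uniq fset_uniq.
have sub : [fset x in take L s] `<=` A.
  by apply/fsubsetP => x; rewrite inE => /mem_take; rewrite mem_sort.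
exists [fset x in take L s]; split => //; split => //.
  rewrite card_fseq undup_id ?take_uniq// size_takel// size_sort. exact: ltnW.
move=> x y; rewrite !inE => xt /andP[yt yA].
move: sP; rewrite (sorted_pairwise rtr) -(cat_take_drop L s) pairwise_cat => /andP[/allrelP H _].
apply: H => //.
have : y \in s by rewrite mem_sort.
by rewrite -{1}(cat_take_drop L s) mem_cat (negbTE yt).
Qed.

Lemma robust_pruning_total p V (alpha : R) : exists O, robust_pruning p V alpha O /\ O `<=` V.
Proof.
rewrite /robust_pruning.
suff H n : forall U O, (#|` U| <= n)%N -> U `<=` V -> O `<=` V -> exists O', pruning_run alpha p U O O' /\ O' `<=` V.
  by apply: (H #|` V `\ p|) ; rewrite ?fsubD1set ?fsub0set.
elim: n => [|n IH] U O Un UV OV.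
  by move: Un; rewrite leqn0 cardfs_eq0 => /eqP ->; exists O; split => //; constructor.
have [->|U0] := eqVneq U fset0; first by exists O; split => //; constructor.
have [v vc] := is_closest_exists p U0.
have [|||O' [r O'V]] := IH [fset w in U `\ v | ~~ (alpha * mdist v w <= mdist p w)] (v |` O).
- have := cardfsD1 v U; rewrite (proj1 vc) => e.
  have /fsubset_leq_card : [fset w in U `\ v | ~~ (alpha * mdist v w <= mdist p w)] `<=` U `\ v by apply/fsubsetP => w; rewrite !inE => /andP[].
  by move/leq_trans; apply; rewrite -ltnS (leq_trans _ Un)// e.
- by apply/fsubsetP => w; rewrite !inE => /andP[/andP[_ /(fsubsetP UV)]].
- by rewrite fsubUset fsub1set (fsubsetP UV) ?(proj1 vc).
by exists O'; split => //; exact: pruning_step r.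
Qed.

Lemma greedy_search_total V N s q L : s \in V -> (forall p, p \in V -> N p `<=` V) ->
  exists tr out, greedy_search N s q L tr out.
Proof.
move=> sV NV.
suff H n : forall A U, (#|` V `\` U| <= n)%N -> A `<=` V -> exists tr out, greedy_run N q L A U tr out.
  by apply: (H #|` V `\` fset0|) => //; rewrite fsub1set.
have D A U : A `\` U = fset0 -> exists tr out, greedy_run N q L A U tr out.
  move=> e; exists [::], (sort (fun x y => mdist x q <= mdist y q) U); apply: greedy_done => //.
  - by rewrite perm_sort.
  - by apply: sort_sorted => x y; exact: le_total.
elim: n => [|n IH] A U Un AV.
  apply: D; apply/eqP; rewrite fsetD_eq0.
  move: Un; rewrite leqn0 cardfs_eq0 fsetD_eq0; exact: fsubset_trans.
have [|A0] := eqVneq (A `\` U) fset0; first exact: D.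
have [v vc] := is_closest_exists q A0.
have [vU vA] : v \notin U /\ v \in A by move: (proj1 vc); rewrite inE => /andP[].
have vV := fsubsetP AV _ vA.
have [A' [At A's]] := truncation_exists L (A `|` N v) q.
have [||tr [out r]] := IH A' (v |` U).
- have -> : V `\` (v |` U) = (V `\` U) `\ v.
    by apply/fsetP => x; rewrite !inE negb_or andbA.
  by rewrite -ltnS (leq_trans _ Un)// (cardfsD1 v (V `\` U)) inE vU vV.
- by apply: (fsubset_trans A's); rewrite fsubUset AV NV.
by exists (v :: tr), out; exact: greedy_step vc At r.
Qed.

End Graph.

(* Main.v *)
(* Fix a nearest neighbour [a] of [q], at distance [r], and let
   [c = (alpha + 1) / (alpha - 1)]. If the scanned vertex [u] does not have [a]
   as an out-neighbour, it has an out-neighbour [p] with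
   [alpha D(p, a) <= D(u, a)], hence
   [D(p, q) <= r + D(p, a) <= (1 + 1 / alpha) r + D(u, q) / alpha]; as [c r] is
   the fixed point of this affine map, the excess of [D(u, q)] over [c r] is
   divided by [alpha] at each step. It is initially at most [D_max], since
   [D(s, q) <= r + D_max]. Once it is at most [D_max / alpha ^ i] with
   [alpha ^ i] of order [(alpha + 1) Delta / ((alpha - 1) eps)], either
   [D_min <= 4 c r] and the excess is at most [eps r], or [4 c r < D_min] and the
   scanned vertex is closer than [D_min] to [a], hence equal to it.
   For the constant in the O: with [E = max 1 eps_max] and
   [T = Delta / ((alpha - 1) eps)], at least one of [alpha] and [T] is bounded
   below by [1 + 1 / (2 E) > 1], which absorbs [log_alpha] of constants into
   [max 1 (log_alpha T)]. *)
Require Import Defs.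
From mathcomp Require Import ring lra.
Import Order.TTheory GRing.Theory Num.Theory.
Local Open Scope fset_scope.
Local Open Scope ring_scope.

Set Implicit Arguments.
Unset Strict Implicit.
Unset Printing Implicit Defensive.

(** * Extremal distances in a finite point set *)

Section Distances.
Context {R : realType} {X : metricType R}.
Implicit Types (V : {fset X}) (q x y a v : X) (c : R).

Lemma is_closest_nn_dist V q a : is_closest V q a -> nn_dist V q = mdist a q.
Proof.
move=> [aV amin]; apply/le_anti/andP; split.
  apply: ge_inf; last by exists a.
  by exists (mdist a q) => r [x xV ->]; exact: amin.
apply: lb_le_inf; first by exists (mdist a q), a.
by move=> r [x xV ->]; exact: amin.
Qed.

(** Attained bounds make the set nonempty and bounded, so [inf] and [sup] carry their usual meaning,
    and they bound [inf] below by a positive distance. *)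
Lemma pairwise_dists_extrema V : (2 <= #|` V|)%N ->
  exists m M, [/\ pairwise_dists V m, pairwise_dists V M &
    forall r, pairwise_dists V r -> m <= r <= M].
Proof.
move=> V2.
have /fset0Pn[x xV] : V != fset0 by rewrite -cardfs_gt0 (ltn_trans _ V2).
have /fset0Pn[y] : V `\ x != fset0.
  by rewrite -cardfs_gt0; move: V2; rewrite (cardfsD1 x) xV.
rewrite !inE eq_sym => /andP[xy yV].
pose P (z : V * V) := val z.1 != val z.2.
pose F (z : V * V) := mdist (val z.1) (val z.2).
have Pxy : P (FSetSub xV, FSetSub yV) by [].
have PF z : P z -> pairwise_dists V (F z).
  by move=> Pz; exists (val z.1), (val z.2); split=> //; exact: valP.
case: (arg_minP F Pxy) => z1 Pz1 min1.
case: (arg_maxP F Pxy) => z2 Pz2 max2.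
exists (F z1), (F z2); split; [exact: PF|exact: PF|].
move=> r [u [w [uV wV uw ->]]].
have Puw : P (FSetSub uV, FSetSub wV) by [].
by apply/andP; split; [exact: (min1 _ Puw)|exact: (max2 _ Puw)].
Qed.

Lemma inf_pairwise_dists_gt0 V : (2 <= #|` V|)%N ->
  0 < inf (pairwise_dists V).
Proof.
move=> /pairwise_dists_extrema[m [M [mP _ mM]]].
have [x [y [_ _ xy mE]]] := mP.
apply: (@lt_le_trans _ _ m); first by rewrite mE mdist_gt0.
by apply: lb_le_inf; [exists m|move=> r /mM/andP[]].
Qed.

Lemma pairwise_dists_bounds V r : (2 <= #|` V|)%N -> pairwise_dists V r ->
  inf (pairwise_dists V) <= r <= sup (pairwise_dists V).
Proof.
move=> /pairwise_dists_extrema[m [M [_ _ mM]]] Vr; apply/andP; split.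
  by apply: ge_inf => //; exists m => s /mM/andP[].
by apply: ub_le_sup => //; exists M => s /mM/andP[].
Qed.

Lemma inf_le_sup_pairwise_dists V : (2 <= #|` V|)%N ->
  inf (pairwise_dists V) <= sup (pairwise_dists V).
Proof.
move=> V2; have [m [M [mP _ _]]] := pairwise_dists_extrema V2.
by have /andP[/le_trans] := pairwise_dists_bounds V2 mP; apply.
Qed.

Lemma mdist_le_sup V x y : (2 <= #|` V|)%N -> x \in V -> y \in V ->
  mdist x y <= sup (pairwise_dists V).
Proof.
move=> V2 xV yV; have [<-|xy] := eqVneq x y.
  rewrite mdistxx (le_trans _ (inf_le_sup_pairwise_dists V2))// ltW//.
  exact: inf_pairwise_dists_gt0.
have Vxy : pairwise_dists V (mdist x y) by exists x, y.
by have /andP[] := pairwise_dists_bounds V2 Vxy.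
Qed.

Lemma mdist_lt_inf V x y : (2 <= #|` V|)%N -> x \in V -> y \in V ->
  mdist x y < inf (pairwise_dists V) -> x = y.
Proof.
move=> V2 xV yV; have [//|xy] := eqVneq x y.
have Vxy : pairwise_dists V (mdist x y) by exists x, y.
by have /andP[mle _] := pairwise_dists_bounds V2 Vxy; rewrite ltNge mle.
Qed.

Lemma aspect_ratio_ge1 V : (2 <= #|` V|)%N -> 1 <= aspect_ratio V.
Proof.
move=> V2; rewrite /aspect_ratio ler_pdivlMr ?inf_pairwise_dists_gt0//.
by rewrite mul1r inf_le_sup_pairwise_dists.
Qed.

End Distances.

(** * Pruned graphs and greedy search with queue length 1 *)

Section Search.
Context {R : realType} {X : metricType R}.
Implicit Types (V U A O : {fset X}) (p q s u v w a : X) (alpha c : R).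
Implicit Types (N : X -> {fset X}).

(** A point leaves [U] either by being selected or because the selected [v] shortcuts it, and [v] is
    never dropped from the output afterwards. *)
Lemma pruning_run_cover alpha p U O O' : pruning_run alpha p U O O' ->
  [/\ O `<=` O', O' `<=` O `|` U & forall w, w \in U ->
    w \in O' \/ exists2 v, v \in O' & alpha * mdist v w <= mdist p w].
Proof.
elim=> {U O O'} [O|U O O' v [vU _] _ [OO' O'U cover]].
  by split; rewrite ?fsubsetUl.
move: OO'; rewrite fsubUset fsub1set => /andP[vO' OO']; split=> //.
  apply: fsubset_trans O'U _; apply/fsubsetP => w; rewrite !inE.
  case/orP => [/orP[/eqP->|->]//|/andP[/andP[_ ->]]]; last by rewrite orbT.
  by rewrite vU orbT.
move=> w wU; have [->|wv] := eqVneq w v; first by left.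
have [le_vw|not_le] := boolP (alpha * mdist v w <= mdist p w).
  by right; exists v.
by apply: cover; rewrite !inE wv wU not_le.
Qed.

Lemma slow_preprocessing_sub V alpha N p :
  slow_preprocessing V alpha N -> p \in V -> N p `<=` V.
Proof.
move=> NV /NV /pruning_run_cover[_ /fsubset_trans + _]; apply.
by rewrite fset0U fsubD1set.
Qed.

Lemma slow_preprocessing_shortcut V alpha N :
  slow_preprocessing V alpha N -> shortcut_reachable V alpha N.
Proof.
move=> NV p q /NV /pruning_run_cover[_ _ cover] qV qp.
by apply: cover; rewrite !inE qp.
Qed.

(** Keeps the queue a singleton. Membership of [u] handles the case without truncation, where [A]
    has at most one point. *)
Lemma truncation1_closest q u A A' : u \in A -> truncation 1 q A A' ->
  exists2 u', A' = [fset u'] & is_closest A q u'.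
Proof.
move=> uA; rewrite /truncation; case: ltnP => [_ [A'A /eqP/cardfs1P[u' eA'] near]|A1 ->].
  subst A'; exists u' => //; split; first by move: A'A; rewrite fsub1set.
  move=> w wA; have [->//|wu'] := eqVneq w u'.
  by apply: near; rewrite !inE ?eqxx// wu' wA.
have /cardfs1P[w Aw] : #|` A| == 1%N.
  by rewrite eqn_leq A1 cardfs_gt0; apply/fset0Pn; exists u.
by exists w => //; rewrite Aw; split=> [|x]; rewrite inE ?eqxx// => /eqP->.
Qed.

Lemma greedy_run1_inv N q u U tr out :
  greedy_run N q 1 [fset u] U tr out -> u \notin U ->
  exists u' tr', [/\ tr = u :: tr', is_closest (u |` N u) q u' &
    greedy_run N q 1 [fset u'] (u |` U) tr' out].
Proof.
move eA: [fset u] => A run uU; case: run eA uU => {A U tr out}.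
  move=> A U out AU _ _ eA uU.
  have : u \in A `\` U by rewrite -eA !inE uU eqxx.
  by rewrite AU inE.
move=> A U A' v tr out [vA _] trunc run eA uU; subst A.
move: vA; rewrite !inE => /andP[_ /eqP vu]; subst v.
have uNu : u \in u |` N u by rewrite !inE eqxx.
have [u' A'u' close] := truncation1_closest uNu trunc.
by exists u', tr; rewrite -A'u'.
Qed.

(* The only obstruction to the decay is a tie: the search stops as soon as it
   would move back to a scanned vertex, but then [u] is already a closest point
   of its out-neighbourhood, and the one-step estimate for [u'] applies to it. *)
Lemma greedy_run1_decay V alpha N q a (e : R) (i : nat) :
  let c := (alpha + 1) / (alpha - 1) in
  1 < alpha -> shortcut_reachable V alpha N ->
  (forall p, p \in V -> N p `<=` V) -> a \in V -> 0 <= e ->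
  forall U u tr out, greedy_run N q 1 [fset u] U tr out ->
  u \in V -> u \notin U -> (forall w, w \in U -> mdist u q <= mdist w q) ->
  mdist u q <= c * mdist a q + e ->
  exists v, [/\ v \in take i.+1 tr, v \in V &
    mdist v q <= c * mdist a q + e / alpha ^+ i].
Proof.
move=> c a1 short NV aV.
have a0 : 0 < alpha by lra.
have c1 : 1 <= c by rewrite ler_pdivlMr; lra.
have c_fix : 1 + alpha^-1 + alpha^-1 * c = c by rewrite /c; field; lra.
have r0 : 0 <= mdist a q := mdist_ge0 _ _.
elim: i e => [|i IHi] e e0 U u tr out run uV uU Ufar ue.
  have [u' [tr' [-> _ _]]] := greedy_run1_inv run uU.
  by exists u; rewrite expr0 divr1 inE eqxx.
have [u' [tr' [-> [u'uN u'min] run']]] := greedy_run1_inv run uU.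
have u'u : mdist u' q <= mdist u q by apply: u'min; rewrite !inE eqxx.
have ea0 : 0 <= e / alpha by rewrite divr_ge0// ltW.
have u'V : u' \in V.
  by move: u'uN; rewrite !inE => /orP[/eqP->//|]; apply: (fsubsetP (NV _ uV)).
(* Stated for any excess [f]: it is applied to [e], and in the tie case to the exact excess of
   [u]. *)
have step f : 0 <= f -> mdist u q <= c * mdist a q + f ->
    mdist u' q <= c * mdist a q + f / alpha.
  move=> f0 uf.
  have u'a : a \in u |` N u -> mdist u' q <= c * mdist a q + f / alpha.
    move=> /u'min /le_trans; apply.
    have fa0 : 0 <= f / alpha by rewrite divr_ge0// ltW.
    by rewrite -[leLHS]addr0 lerD// ler_peMl.
  have [au|au] := eqVneq a u; first by apply: u'a; rewrite au !inE eqxx.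
  have [aN|[p pN pa]] := short u a uV aV au; first by apply: u'a; rewrite !inE aN orbT.
  have pq : mdist u' q <= mdist p q by apply: u'min; rewrite !inE pN orbT.
  apply: (le_trans pq); apply: (le_trans (metric_triangle _ a _)).
  have ua := metric_triangle u q a.
  rewrite (metric_sym q a) in ua.
  have {}pa : mdist p a <= alpha^-1 * (c * mdist a q + f + mdist a q).
    by rewrite mulrC ler_pdivlMr// mulrC (le_trans pa)// (le_trans ua)// lerD2r.
  have -> : c * mdist a q + f / alpha =
      alpha^-1 * (c * mdist a q + f + mdist a q) + mdist a q.
    by rewrite -{1}c_fix; ring.
  by rewrite lerD2r.
have [u'U|u'U] := boolP (u' \in u |` U).
  exists u; rewrite inE eqxx; split=> //.
  have uu' : mdist u q <= mdist u' q.
    by move: u'U; rewrite !inE => /orP[/eqP->//|/Ufar].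
  suff : mdist u q <= c * mdist a q.
    by move=> /le_trans; apply; rewrite lerDl divr_ge0// exprn_ge0// ltW.
  (* A positive excess [f] of [u] would satisfy [f <= f / alpha], since [u'] is no closer to [q]
     than [u]. *)
  rewrite leNgt; apply/negP => far.
  pose f := mdist u q - c * mdist a q.
  have f0 : 0 < f by rewrite subr_gt0.
  have := le_trans uu' (step f (ltW f0) _).
  rewrite {1}/f addrC subrK lexx => /(_ isT).
  rewrite -lerBlDl -/f ler_pdivlMr//.
  by rewrite ger_pMr// leNgt a1.
have u'e := step e e0 ue.
have [|v [vt vV ve]] := IHi _ ea0 _ _ _ _ run' u'V u'U _ u'e.
  move=> w; rewrite !inE => /orP[/eqP->//|/Ufar]; exact: le_trans.
exists v; split=> //; first by rewrite /= inE vt orbT.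
by rewrite exprS invfM mulrA.
Qed.

End Search.

(** * Number of steps and final accuracy *)

Lemma step_count (R : realType) (E alpha eps rho : R) :
  let T := rho / ((alpha - 1) * eps) in
  1 <= E -> 1 < alpha -> 0 < eps -> eps <= E -> 1 <= rho ->
  exists2 i : nat, 4 * (alpha + 1) * (E * T) <= alpha ^+ i &
    i.+1%:R <= (4 + ln (8 * E) / ln (1 + (2 * E)^-1))
               * Num.max 1 (logb alpha T).
Proof.
move=> T E1 a1 eps0 epsE rho1.
have E0 : 0 < E by lra.
have a10 : 0 < alpha - 1 by lra.
have aeps0 : 0 < (alpha - 1) * eps by rewrite mulr_gt0.
have T0 : 0 < T by rewrite divr_gt0//; lra.
have ET0 : 0 < E * T := mulr_gt0 E0 T0.
have lna0 : 0 < ln alpha := ln_gt0 a1.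
have d0 : 0 < (2 * E)^-1 by rewrite invr_gt0; lra.
have d1 : (2 * E)^-1 <= 1 by rewrite invf_le1; lra.
have lnd0 : 0 < ln (1 + (2 * E)^-1) by rewrite ln_gt0//; lra.
have lnE0 : 0 <= ln (8 * E) by rewrite ln_ge0//; lra.
set m := Num.max 1 _.
have m1 : 1 <= m by rewrite le_max lexx.
have mT : ln T <= m * ln alpha by rewrite -ler_pdivrMr// le_max lexx orbT.
have md : ln (1 + (2 * E)^-1) <= m * ln alpha.
  have [ad|da] := lerP (1 + (2 * E)^-1) alpha.
    apply: (@le_trans _ _ (ln alpha)); last by rewrite ler_peMl// ltW.
    by rewrite ler_ln ?posrE//; lra.
  (* Here [alpha - 1 < 1 / (2 E)] and [eps <= E], so [T >= 2]. *)
  apply: le_trans mT; rewrite ler_ln ?posrE//; last lra.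
  apply: (@le_trans _ _ 2); first lra.
  rewrite /T ler_pdivlMr//; apply: le_trans rho1.
  have /ltW : (alpha - 1) * (2 * E) < 1 by rewrite -ltr_pdivlMr; lra.
  apply: le_trans; rewrite mulrCA ler_pM2l// mulrC; nra.
have ETa : 1 <= alpha * (E * T).
  apply: (@le_trans _ _ ((alpha - 1) * (E * T))); last first.
    by rewrite ler_pM2r//; lra.
  have -> : (alpha - 1) * (E * T) = rho * (E / eps) by rewrite /T; field; lra.
  have : 1 <= E / eps by rewrite ler_pdivlMr// mul1r.
  nra.
have alpha0 : 0 < alpha by lra.
have E80 : 0 < 8 * E by lra.
have aT0 : 0 < alpha * T := mulr_gt0 alpha0 T0.
(* [K] dominates the target because [alpha + 1 <= 2 alpha]. By [ETa] it is at least 8, so its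
   logarithm is nonnegative and can be truncated. *)
pose K := 8 * E * (alpha * T).
have KE : K = 8 * (alpha * (E * T)) by rewrite /K; ring.
have lnK0 : 0 <= ln K by rewrite ln_ge0// KE; lra.
have lnKE : ln K = ln (8 * E) + (ln alpha + ln T).
  by rewrite /K lnM ?posrE// [ln (alpha * T)]lnM ?posrE.
have x0 : 0 <= ln K / ln alpha by rewrite divr_ge0// ltW.
have /andP[ix xi] := truncn_itv x0.
exists (Num.trunc (ln K / ln alpha)).+1.
  apply: (@le_trans _ _ K).
    by rewrite KE (mulrA 8) ler_pM2r//; lra.
  rewrite -ler_ln ?posrE ?exprn_gt0//; last (rewrite KE; lra).
  by rewrite lnXn// -mulr_natl -ler_pdivrMr// ltW.
rewrite 2!mulrSr -addrA.
(* In the constant 4, rounding up and the final successor account for 2, [ln alpha] and [ln T] for 1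
   each; [ln (8 * E)] gives the quotient term. *)
apply: (@le_trans _ _ (ln K / ln alpha + 2)); first by lra.
rewrite -lerBrDr ler_pdivrMr// lnKE.
have B : ln (8 * E) <= ln (8 * E) / ln (1 + (2 * E)^-1) * (m * ln alpha).
  by rewrite mulrAC -mulrA ler_peMr// ler_pdivlMr// mul1r.
have := ler_wpM2r (ltW lna0) m1.
nra.
Qed.

(** The two entries of [Num.max 1 eps] serve the two cases: 1 yields [A1] for a distant query, [eps]
    yields [A2] for a query near [a]. *)
Lemma approx_nn_of_decay (R : realType) (X : metricType R) (V : {fset X})
    (alpha eps A : R) (q a v : X) :
  (2 <= #|` V|)%N -> 1 < alpha -> 0 < eps -> is_closest V q a -> v \in V ->
  4 * (alpha + 1) * (Num.max 1 eps * (aspect_ratio V / ((alpha - 1) * eps)))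
    <= A ->
  mdist v q <= (alpha + 1) / (alpha - 1) * mdist a q
               + sup (pairwise_dists V) / A ->
  approx_nn V ((alpha + 1) / (alpha - 1) + eps) q v.
Proof.
move=> V2 a1 eps0 close vV; rewrite /approx_nn (is_closest_nn_dist close).
have [aV _] := close.
have := aspect_ratio_ge1 V2; have := inf_pairwise_dists_gt0 V2.
rewrite /aspect_ratio.
have := mdist_lt_inf V2 vV aV.
set m := inf _; set M := sup _; set r := mdist a q; set c := (alpha + 1) / _.
move=> va m0; rewrite ler_pdivlMr// mul1r => mM TA vq.
have r0 : 0 <= r := mdist_ge0 _ _.
have c1 : 1 <= c by rewrite ler_pdivlMr; lra.
have M0 : 0 < M by lra.
have T0 : 0 < M / m / ((alpha - 1) * eps).
  by rewrite !divr_gt0 ?mulr_gt0//; lra.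
have A1 : 4 * c * M <= eps * m * A.
  have -> : 4 * c * M =
      eps * m * (4 * (alpha + 1) * (M / m / ((alpha - 1) * eps))).
    by rewrite /c; field; lra.
  rewrite ler_pM2l ?mulr_gt0//; apply: le_trans TA.
  rewrite ler_pM2l; last lra.
  by rewrite ler_peMl ?le_max ?lexx// ltW.
have A2 : 4 * M <= m * A.
  apply: (@le_trans _ _ (4 * c * M)); first by nra.
  have -> : 4 * c * M =
      m * (4 * (alpha + 1) * (eps * (M / m / ((alpha - 1) * eps)))).
    by rewrite /c; field; lra.
  rewrite ler_pM2l//; apply: le_trans TA.
  rewrite ler_pM2l; last lra.
  by rewrite ler_pM2r// le_max lexx orbT.
have A0 : 0 < A by rewrite -(pmulr_rgt0 _ m0); lra.
split=> //; rewrite mulrDl.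
have [far|near] := lerP m (4 * c * r).
  apply: (le_trans vq); rewrite lerD2l ler_pdivrMr//.
  rewrite -(@ler_pM2l _ (4 * c)); last lra.
  apply: (le_trans A1).
  have -> : 4 * c * (eps * r * A) = eps * (4 * c * r) * A by ring.
  by rewrite ler_pM2r// ler_pM2l.
have MA : M / A <= m / 4.
  by rewrite ler_pdivrMr//; lra.
(* Each of [c r], [M / A] and [r] is at most [m / 4], so [v] and [a] are less than [m] apart. *)
have -> : v = a.
  apply: va; apply: (le_lt_trans (metric_triangle _ q _)).
  rewrite (metric_sym q a) -/r.
  have : r <= c * r by rewrite ler_peMl.
  lra.
rewrite -/r; nra.
Qed.

(** [C] depends only on [eps_max], uniformly in the space, the graph and [alpha]. The maximum with 1
    is there because the logarithm may be negative; [take n tr] is all of [tr] when the search stops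
    early. *)
Theorem theorem1 (R : realType) (eps_max : R) :
  exists2 C : R, 0 < C &
    forall (X : metricType R) (V : {fset X}) (alpha : R) (N : X -> {fset X}),
      (2 <= #|` V|)%N -> 1 < alpha -> slow_preprocessing V alpha N ->
      shortcut_reachable V alpha N /\
      forall (s q : X) (eps : R) (tr out : seq X),
        s \in V -> 0 < eps -> eps <= eps_max ->
        greedy_search N s q 1 tr out ->
        exists (n : nat) (v : X),
          [/\ n%:R <= C * Num.max 1
                (logb alpha (aspect_ratio V / ((alpha - 1) * eps))),
              v \in take n tr &
              approx_nn V ((alpha + 1) / (alpha - 1) + eps) q v].
Proof.
pose E := Num.max 1 eps_max.
have E1 : 1 <= E by rewrite le_max lexx.
exists (4 + ln (8 * E) / ln (1 + (2 * E)^-1)).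
  have d0 : 0 < (2 * E)^-1 by rewrite invr_gt0; lra.
  by rewrite ltr_wpDr// divr_ge0// ln_ge0//; lra.
move=> X V alpha N V2 a1 NV; have short := slow_preprocessing_shortcut NV.
split=> // s q eps tr out sV eps0 epsM run.
have epsE : eps <= E by rewrite le_max epsM orbT.
have [a close] : exists a, is_closest V q a.
  by apply: is_closest_exists; apply/fset0Pn; exists s.
have aV := proj1 close.
have rho1 := aspect_ratio_ge1 V2.
have [i Ti iC] := step_count E1 a1 eps0 epsE rho1.
have M0 : 0 <= sup (pairwise_dists V).
  by rewrite (le_trans _ (mdist_le_sup V2 sV sV))// mdist_ge0.
have start : mdist s q <=
    (alpha + 1) / (alpha - 1) * mdist a q + sup (pairwise_dists V).
  apply: (le_trans (metric_triangle _ a _)); rewrite addrC lerD//.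
    rewrite ler_peMl ?mdist_ge0// ler_pdivlMr; lra.
  exact: mdist_le_sup.
have [//|//|v [vt vV vq]] := greedy_run1_decay i a1 short
  (fun p => slow_preprocessing_sub NV) aV M0 run sV _ _ start.
exists i.+1, v; split=> //.
apply: (approx_nn_of_decay V2 a1 eps0 close vV _ vq).
(* The count was made with [E], which bounds [Num.max 1 eps]. *)
apply: le_trans Ti; rewrite ler_pM2l; last lra.
rewrite ler_wpM2r ?ge_max ?E1//.
have al0 : 0 <= alpha - 1 by lra.
exact: divr_ge0 (le_trans ler01 rho1) (mulr_ge0 al0 (ltW eps0)).
Qed.
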